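(* Suppose the entries of two $n\times n$ Boolean matrices $A$ and $B$ are drawn uniformly and independently at random. Then the expected running time of algorithm QuickMultiply on $(A,B)$ is $O(n^2)$.
   Context: Algorithm QuickMultiply$(A,B)$, for $A=(a_{i,j})$, $B=(b_{i,j})$ Boolean $n\times n$ matrices, computes the Boolean product $C=(c_{i,j})$ as follows: for $i=1,\ldots,n$, let $j_1<\cdots<j_m$ be the indices with $a_{i,j_k}=1$; then for $j=1,\ldots,n$, search the list $b_{j_1,j},\ldots,b_{j_m,j}$ sequentially (in this order) for a bit $1$, and set $c_{i,j}=1$ if a $1$ is found and $c_{i,j}=0$ otherwise. Running time counts the elementary steps, in particular every bit examined in the sequential searches. *)

(* Defs.v *)
From HB Require Import structures.
From mathcomp Require Import all_boot all_order all_algebra.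
From mathcomp Require Import all_classical all_reals all_analysis.

Set Implicit Arguments.
Unset Strict Implicit.
Unset Printing Implicit Defensive.

Import Order.TTheory GRing.Theory Num.Theory.

Section QuickMultiply.
Local Open Scope nat_scope.

(* Number of elementary steps charged to each operation; the asymptotic bound
   is claimed for every choice of these constants. *)
Record step_costs := StepCosts {
  cost_start : nat;  (* once per run *)
  cost_row   : nat;  (* per row index i: overhead of the outer loop *)
  cost_scan  : nat;  (* per entry of row i of A inspected to list j_1 < ... < j_m *)
  cost_store : nat;  (* per index j_k appended to that list *)
  cost_entry : nat;  (* per pair (i, j): inner loop overhead, writing c_(i,j),
                        and detecting the end of the list *)
  cost_probe : nat   (* per bit b_(j_k, j) examined *)
}.

Variable c : step_costs.

(* Each procedure returns its result paired with its number of steps. *)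

Fixpoint list_ones (I : Type) (a : I -> bool) (s : seq I) : seq I * nat :=
  if s is j :: s' then
    let: (l, t) := list_ones a s' in
    if a j then (j :: l, cost_scan c + cost_store c + t)
    else (l, cost_scan c + t)
  else ([::], 0).

Fixpoint search_one (I : Type) (b : I -> bool) (l : seq I) : bool * nat :=
  if l is k :: l' then
    if b k then (true, cost_probe c)
    else let: (r, t) := search_one b l' in (r, cost_probe c + t)
  else (false, 0).

(* [enum 'I_n] is in increasing order, hence so is the list of indices. *)
Definition quick_multiply n (A B : 'M[bool]_n) : 'M[bool]_n * nat :=
  let ones i := list_ones (fun j => A i j) (enum 'I_n) in
  let entry i j := search_one (fun k => B k j) (ones i).1 in
  ((\matrix_(i, j) (entry i j).1)%R,
   cost_start c +
   \sum_(i < n) (cost_row c + (ones i).2 +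
                 \sum_(j < n) (cost_entry c + (entry i j).2))).

Lemma list_ones_fst (I : Type) (a : I -> bool) (s : seq I) :
  (list_ones a s).1 = [seq j <- s | a j].
Proof. by elim: s => //= j s <-; case: (list_ones a s) => l t; case: (a j). Qed.

Lemma search_one_fst (I : Type) (b : I -> bool) (l : seq I) :
  (search_one b l).1 = has b l.
Proof. by elim: l => //= k l <-; case: (b k) => //; case: (search_one b l). Qed.

Lemma quick_multiply_correct n (A B : 'M[bool]_n) i j :
  (quick_multiply A B).1 i j = [exists k, A i k && B k j].
Proof.
rewrite mxE search_one_fst list_ones_fst; apply/hasP/existsP => [[k]|[k /andP[Aik Bkj]]].
  by rewrite mem_filter => /andP[Aik _] Bkj; exists k; rewrite Aik.
by exists k => //; rewrite mem_filter Aik mem_enum.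
Qed.

End QuickMultiply.

Definition running_time (c : step_costs) n (A B : 'M[bool]_n) : nat :=
  (quick_multiply c A B).2.

Section RandomMatrices.
Local Open Scope classical_set_scope.
Local Open Scope ring_scope.
Local Open Scope ereal_scope.

Context {d : measure_display} {T : measurableType d} {R : realType}.
Variable P : probability T R.

(* Product rule over every subfamily J and all measurable sets of values. *)
Definition mutually_independent d' (T' : measurableType d') (I : finType)
    (X : I -> {RV P >-> T'}) : Prop :=
  forall (J : {set I}) (S : I -> set T'), (forall k, measurable (S k)) ->
    P [set w | forall k, k \in J -> S k (X k w)] =
    \prod_(k in J) P (X k @^-1` S k).

Definition uniform_bit (X : {RV P >-> bool}) : Prop :=
  forall b : bool, P (X @^-1` [set b]) = (2%:R^-1 : R)%:E.

(* The entries of A and B as one family: [inl (i, j)] is the entry (i, j) of A,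
   [inr (i, j)] that of B. *)
Definition entries_of n (A B : 'M[{RV P >-> bool}]_n)
    (k : 'I_n * 'I_n + 'I_n * 'I_n) : {RV P >-> bool} :=
  match k with inl ij => A ij.1 ij.2 | inr ij => B ij.1 ij.2 end.

Definition iid_uniform_entries n (A B : 'M[{RV P >-> bool}]_n) : Prop :=
  (forall k, uniform_bit (entries_of A B k)) /\
  mutually_independent (entries_of A B).

Definition realization n (A : 'M[{RV P >-> bool}]_n) (w : T) : 'M[bool]_n :=
  map_mx (fun X : {RV P >-> bool} => X w) A.

Definition expected_running_time (c : step_costs) n
    (A B : 'M[{RV P >-> bool}]_n) : \bar R :=
  'E_P[fun w => (running_time c (realization A w) (realization B w))%:R].

End RandomMatrices.

(* Main.v *)
(** Fix i and j. Given the row i of A, with ones in columns j_1 < ... < j_l, the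
    search reads its (m+1)-st bit exactly when the first m bits b_(j_1, j), ...,
    b_(j_m, j) are all 0. Prescribing the whole row of A and these m bits of B
    constrains n + m distinct entries, an event of probability 2^-(n + m). As
    there are 2^n possible rows, the expected number of bits read is at most
    2^n * sum_m 2^-(n + m) <= 2; all other costs are deterministically O(n^2). *)

Require Import Defs.
From HB Require Import structures.
From mathcomp Require Import all_boot all_order all_algebra.
From mathcomp Require Import all_classical all_reals all_analysis.

Set Implicit Arguments.
Unset Strict Implicit.
Unset Printing Implicit Defensive.

From mathcomp Require Import measurable_realfun ring zify.
Import Order.TTheory GRing.Theory Num.Theory.

Local Open Scope ring_scope.

(** * Deterministic bound on the running time by the number of probes *)

Definition step_total (c : step_costs) : nat :=
  cost_start c + cost_row c + cost_scan c + cost_store c + cost_entry c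
  + cost_probe c.

Definition ones n (a : 'I_n -> bool) : seq 'I_n := [seq k <- enum 'I_n | a k].

(** Bits read are counted by a sum of indicators rather than by recursion along the list, so that
    expectations can be taken term by term. *)
Definition probes n (A B : 'M[bool]_n) (i j : 'I_n) : nat :=
  (\sum_(m < size (ones (A i))) all (fun k => ~~ B k j) (take m (ones (A i))))%N.

Lemma search_one_snd (c : step_costs) (I : Type) (b : I -> bool) (l : seq I) :
  (search_one c b l).2 =
  (cost_probe c * \sum_(m < size l) all (fun k => ~~ b k) (take m l))%N.
Proof.
elim: l => [|k l IHl] /=; first by rewrite big_ord0 muln0.
(* The term [m = 0] tests the empty prefix, so it equals 1: the first bit is always read. If that
   bit is 1, every longer prefix contains it and the other terms vanish. *)
rewrite big_ord_recl /=.
have [bk|bk] := boolP (b k).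
  by rewrite big1 ?addn0 ?muln1// => m _; rewrite /= bk.
case: (search_one c b l) IHl => r t /= ->; rewrite mulnDr muln1; congr addn.
Qed.

Lemma list_ones_snd_le (c : step_costs) (I : Type) (a : I -> bool) (s : seq I) :
  ((list_ones c a s).2 <= (cost_scan c + cost_store c) * size s)%N.
Proof.
elim: s => //= j s; case: (list_ones c a s) => l t /= IHs.
by case: (a j) => /=; lia.
Qed.

(** The summand 1 absorbs all overheads: each inner sum is at least [n], which pays for listing the
    ones of a row, and the double sum is at least 1, which pays for [cost_start]. The latter fails
    for [n = 0], where the double sum is empty. *)
Lemma running_time_le (c : step_costs) n (A B : 'M[bool]_n) :
  (0 < n)%N ->
  (running_time c A B <=
   step_total c * \sum_(i < n) \sum_(j < n) (1 + probes A B i j))%N.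
Proof.
move=> n_gt0; rewrite /running_time /= /step_total.
set r := (\sum_(i < n) \sum_(j < n) _)%N.
have le_start : (cost_start c <= cost_start c * r)%N.
  rewrite leq_pmulr// /r; pose i0 := Ordinal n_gt0.
  by rewrite (bigD1 i0)//= (bigD1 i0)//= -!addnA.
apply: (@leq_trans (cost_start c * r + (cost_row c + cost_scan c + cost_store c +
    cost_entry c + cost_probe c) * r)); last by lia.
rewrite leq_add// big_distrr leq_sum//= => i _.
have := list_ones_snd_le c (fun j => A i j) (enum 'I_n).
rewrite size_enum_ord => le_scan.
set q := (\sum_(j < n) (1 + _))%N.
have le_nq : (n <= q)%N.
  by rewrite -{1}[n]card_ord -sum1_card; apply: leq_sum => j _; rewrite leq_addr.
have le_search : (\sum_(j < n) (cost_entry c + (search_one c (fun k => B k j)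
     (list_ones c (fun k => A i k) (enum 'I_n)).1).2)
    <= (cost_entry c + cost_probe c) * q)%N.
  rewrite big_distrr leq_sum//= => j _.
  by rewrite search_one_snd list_ones_fst -/(ones (A i)) -/(probes A B i j); nia.
have le_row : (cost_row c <= cost_row c * q)%N.
  by rewrite leq_pmulr// (leq_trans n_gt0).
have le_scan' := leq_mul (leqnn (cost_scan c + cost_store c)%N) le_nq.
apply: leq_trans (leq_add (leq_add (leqnn _) le_scan) le_search) _; lia.
Qed.

(** * Events that prescribe finitely many bits *)

Section Bits.
Local Open Scope classical_set_scope.
Context {d : measure_display} {T : measurableType d} {R : realType}.
Variables (P : probability T R) (I : finType) (X : I -> {RV P >-> bool}).

Definition cylinder (J : {set I}) (v : I -> bool) : set T :=
  [set w | forall k, k \in J -> X k w = v k].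

Lemma measurable_cylinder J v : measurable (cylinder J v).
Proof.
have -> : cylinder J v = \bigcap_(k in [set` J]) (X k @^-1` [set v k]) by [].
apply: fin_bigcap_measurable => // k _.
by rewrite -[_ @^-1` _]setTI; exact: measurable_funPT.
Qed.

Lemma probability_cylinder J v :
  (forall k, uniform_bit (X k)) -> mutually_independent X ->
  P (cylinder J v) = (2^-1 ^+ #|J|)%:E.
Proof.
move=> unif indep; rewrite (indep J (fun k => [set v k]))//.
under eq_bigr => k _ do rewrite unif.
by rewrite prodEFin prodr_const.
Qed.

(** There are finitely many bit vectors, and the cylinders over all of [I] partition [T] according
    to them, so the function is a finite combination of indicators. *)
Lemma measurable_of_bits (f : {ffun I -> bool} -> R) :
  measurable_fun [set: T] (fun w => f [ffun k => X k w]).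
Proof.
rewrite (_ : (fun w => _) = fun w =>
    \sum_(x : {ffun I -> bool}) f x * \1_(cylinder [set: I] x) w).
  apply: measurable_sum => x; apply: measurable_funM => //.
  exact/measurable_indicP/measurable_cylinder.
apply/funext => w; set x0 := [ffun k => X k w].
rewrite (bigD1 x0)//= indicE mem_set ?mulr1; last first.
  by move=> k _; rewrite ffunE.
rewrite big1 ?addr0// => x neq; rewrite indicE memNset ?mulr0// => xw.
by move/eqP: neq; apply; apply/ffunP => k; rewrite ffunE -xw ?inE.
Qed.

End Bits.

Lemma ge0_expectation_sum {d : measure_display} {T : measurableType d}
    {R : realType} (P : probability T R) (I : Type) (s : seq I)
    (f : I -> T -> R) :
  (forall k, measurable_fun setT (f k)) -> (forall k w, 0 <= f k w) ->
  ('E_P[fun w => (\sum_(k <- s) f k w)%R] = \sum_(k <- s) 'E_P[f k])%E.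
Proof.
move=> mf f0; rewrite unlock.
rewrite -ge0_integral_sum//.
- by apply: eq_integral => w _; rewrite -sumEFin.
- by move=> k; exact/measurable_EFinP.
- by move=> k w _; rewrite lee_fin.
Qed.

Lemma ge0_expectationZl {d : measure_display} {T : measurableType d}
    {R : realType} (P : probability T R) (f : T -> R) (k : R) :
  measurable_fun setT f -> (forall w, 0 <= f w) -> 0 <= k ->
  ('E_P[fun w => (k * f w)%R] = k%:E * 'E_P[f])%E.
Proof.
move=> mf f0 k0; rewrite unlock -ge0_integralZl//.
- exact/measurable_EFinP.
- by move=> w _; rewrite lee_fin.
Qed.

Lemma geometric_half_le2 (R : realFieldType) N :
  \sum_(m < N) (2^-1 : R) ^+ m <= 2.
Proof.
(* The bound 2 alone does not pass through induction; the closed form does. *)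
suff -> : \sum_(m < N) (2^-1 : R) ^+ m = 2 - 2 * 2^-1 ^+ N.
  by rewrite gerBl mulr_ge0// exprn_ge0.
elim: N => [|N IHN]; first by rewrite big_ord0 expr0 mulr1 subrr.
by rewrite big_ord_recr/= IHN exprS; field.
Qed.

(** * Expected number of probes for one pair of indices *)

Section ExpectedProbes.
Context {d : measure_display} {T : measurableType d} {R : realType}.
Variables (P : probability T R) (n : nat) (A B : 'M[{RV P >-> bool}]_n).

(** Here [a] is a fixed candidate for row [i] of A, so this set of entries is not random. Putting
    the whole row into the event replaces conditioning on it. *)
Definition examined (i j : 'I_n) (a : 'I_n -> bool) (m : nat) :
    {set 'I_n * 'I_n + 'I_n * 'I_n} :=
  [set inl (i, k) | k in 'I_n] :|: [set inr (k, j) | k in take m (ones a)].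

(** The value [false] on the B side stands for an unsuccessful probe. Values outside [examined] do
    not affect the cylinder. *)
Definition pattern (a : 'I_n -> bool) (k : 'I_n * 'I_n + 'I_n * 'I_n) : bool :=
  if k is inl ik then a ik.2 else false.

Lemma card_examined i j a m :
  (m <= size (ones a))%N -> #|examined i j a m| = (n + m)%N.
Proof.
move=> lem; rewrite cardsU.
rewrite (_ : _ :&: _ = finset.set0) ?cards0 ?subn0; last first.
  by apply/setP => k; rewrite !inE; apply/negP => /andP[/imsetP[? _ ->] /imsetP[]].
rewrite !card_imset; [|by move=> x y [->]..].
rewrite card_ord (card_uniqP _) ?size_takel//.
by rewrite take_uniq// filter_uniq// enum_uniq.
Qed.

Lemma probesE i j w :
  (probes (realization A w) (realization B w) i j)%:R =
  \sum_(a : {ffun 'I_n -> bool}) \sum_(m < size (ones a))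
    \1_(cylinder (entries_of A B) (examined i j a m) (pattern a)) w :> R.
Proof.
pose a0 := [ffun k => A i k w].
have ones0 : ones (realization A w i) = ones a0.
  by apply: eq_filter => k; rewrite mxE ffunE.
(* Only the actual row [a0] contributes: a cylinder for another [a] prescribes a wrong value
   somewhere in row [i] of A. *)
rewrite (bigD1 a0)//= [X in _ + X]big1 ?addr0; last first.
  move=> a neq; apply: big1 => m _; rewrite indicE memNset// => aw.
  move/eqP: neq; apply; apply/ffunP => k; rewrite ffunE.
  by have /= -> := aw (inl (i, k)); rewrite ?inE ?imset_f.
rewrite /probes ones0 natr_sum; apply: eq_bigr => m _.
rewrite indicE; congr (nat_of_bool _)%:R; apply/idP/idP.
  move=> /allP zeros; rewrite inE => -[] [i' k] /finset.setUP[]/imsetP[l lm] //=.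
    by case=> -> ->; rewrite ffunE.
  by case=> -> ->; apply/negbTE; have := zeros _ lm; rewrite mxE.
rewrite inE => zeros; apply/allP => k km; rewrite mxE.
by rewrite (zeros (inr (k, j)))// inE orbC imset_f.
Qed.

Lemma measurable_probes i j :
  measurable_fun [set: T]
    (fun w => (probes (realization A w) (realization B w) i j)%:R : R).
Proof.
under eq_fun do rewrite probesE.
apply: measurable_sum => a; apply: measurable_sum => m.
exact/measurable_indic/measurable_cylinder.
Qed.

(** Needed for monotonicity of expectation, which is applied with measurability of the smaller
    function too. *)
Lemma measurable_running_time c :
  measurable_fun [set: T]
    (fun w => (running_time c (realization A w) (realization B w))%:R : R).
Proof.
pose f (x : {ffun 'I_n * 'I_n + 'I_n * 'I_n -> bool}) : R :=
  (running_time c (\matrix_(i, j) x (inl (i, j)))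
                  (\matrix_(i, j) x (inr (i, j))))%:R.
rewrite (_ : (fun w => _) = fun w => f [ffun k => entries_of A B k w]).
  exact: measurable_of_bits.
apply/funext => w; rewrite /f; congr (running_time _ _ _)%:R;
  by apply/matrixP => i j; rewrite !mxE ffunE.
Qed.

Lemma expected_probes_le2 i j :
  iid_uniform_entries A B ->
  ('E_P[fun w => (probes (realization A w) (realization B w) i j)%:R] <= 2%:E)%E.
Proof.
move=> [unif indep]; under eq_fun do rewrite probesE.
rewrite ge0_expectation_sum; last 2 first.
- move=> a; apply: measurable_sum => m.
  exact/measurable_indic/measurable_cylinder.
- by move=> a w; apply: sumr_ge0.
(* For each row [a], the factor [2^-1 ^+ n] comes from its [n] entries and 2 bounds the geometric
   series over [m]. Summing over the [2 ^ n] rows then cancels the first factor. *)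
apply: (@le_trans _ _ (\sum_(a : {ffun 'I_n -> bool}) (2^-1 ^+ n * 2 : R)%:E)%E).
  apply: lee_sum => a _; rewrite ge0_expectation_sum//; last first.
    move=> m; exact/measurable_indic/measurable_cylinder.
  under eq_bigr => m _.
    rewrite expectation_indic; last exact: measurable_cylinder.
    rewrite probability_cylinder// card_examined ?exprD; last exact: ltnW.
    over.
  rewrite sumEFin lee_fin -mulr_sumr ler_wpM2l ?exprn_ge0 ?invr_ge0//.
  exact: geometric_half_le2.
rewrite sumEFin lee_fin sumr_const card_ffun card_bool card_ord.
rewrite -[_ *+ (2 ^ n)]mulr_natr.
rewrite mulrAC natrX -exprMn mulVf ?expr1n ?mul1r//.
Qed.

End ExpectedProbes.

Theorem theorem3 (R : realType) (c : step_costs) :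
  exists (K : R) (n0 : nat),
    forall (n : nat) (d : measure_display) (T : measurableType d)
           (P : probability T R) (A B : 'M[{RV P >-> bool}]_n),
      (n0 <= n)%N ->
      iid_uniform_entries A B ->
      (expected_running_time c A B <= (K * n%:R ^+ 2)%:E)%E.
Proof.
(* The 3 is 1 for the overhead of a pair plus 2 for its expected probes; [n0 = 1] meets the
   positivity hypothesis of [running_time_le]. *)
exists (3 * (step_total c)%:R), 1%N => n d T P A B n_gt0 iid.
pose Y i j w : R := 1 + (probes (realization A w) (realization B w) i j)%:R.
have mY i j : measurable_fun setT (Y i j).
  by apply: measurable_funD => //; exact: measurable_probes.
have Y0 i j w : 0 <= Y i j w by rewrite addr_ge0.
have EY i j : ('E_P[Y i j] <= 3%:E)%E.
  have := expected_probes_le2 i j iid; rewrite unlock => le2.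
  under eq_integral => w _ do rewrite EFinD.
  rewrite ge0_integralD//; last first.
    by apply/measurable_EFinP; exact: measurable_probes.
  rewrite (integral_cst P measurableT 1%E) [X in (1 * X)%E]probability_setT mule1.
  by rewrite (_ : 3 = 1 + 2 :> R) ?EFinD ?leeD2l// -natrD.
apply: (@le_trans _ _ 'E_P[fun w =>
    ((step_total c)%:R * \sum_(i < n) \sum_(j < n) Y i j w)%R]%E).
  apply: expectation_le => //.
  - exact: measurable_running_time.
  - apply: measurable_funM => //.
    by apply: measurable_sum => i; apply: measurable_sum => j.
  - by move=> w; rewrite mulr_ge0// sumr_ge0// => i _; rewrite sumr_ge0.
  apply: aeW => w; apply: le_trans (_ : (step_total c *
    \sum_(i < n) \sum_(j < n)
      (1 + probes (realization A w) (realization B w) i j))%N%:R <= _).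
    by rewrite ler_nat running_time_le.
  rewrite natrM natr_sum ler_wpM2l// ler_sum// => i _.
  by rewrite natr_sum ler_sum// => j _; rewrite natrD.
have -> : ('E_P[fun w => ((step_total c)%:R * \sum_(i < n) \sum_(j < n) Y i j w)%R]
  = (step_total c)%:R%:E * \sum_(i < n) \sum_(j < n) 'E_P[Y i j])%E.
  rewrite ge0_expectationZl//.
  - rewrite ge0_expectation_sum//.
    + by congr (_ * _)%E; apply: eq_bigr => i _; rewrite ge0_expectation_sum.
    + by move=> i; exact: measurable_sum.
    + by move=> i w; rewrite sumr_ge0.
  - by apply: measurable_sum => i; exact: measurable_sum.
  - by move=> w; rewrite sumr_ge0// => i _; rewrite sumr_ge0.
apply: (@le_trans _ _ ((step_total c)%:R%:E * \sum_(i < n) \sum_(j < n) 3%:E)%E).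
  by rewrite lee_wpmul2l ?lee_fin//; apply: lee_sum => i _; apply: lee_sum => j _.
under eq_bigr do rewrite sumEFin.
rewrite sumEFin -EFinM lee_fin !sumr_const card_ord.
by rewrite -mulrnA -[3 *+ _]mulr_natr natrM expr2 mulrCA mulrA.
Qed.
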